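(* Let $\beta\in\mathbb{R}$, $\rho_\pm>0$, $u_\pm\ge0$ be constants with $u_+<u_-$, and set $A_0=\rho_-(u_--u_+)$. Let $A_1>A_0$ be such that $u_--\frac{A}{\rho_-}<u_+<u_-$ for all $A_0<A<A_1$. For each fixed $A\in(A_0,A_1)$ let $(\rho,u)=(\rho^A,u^A)$ be the solution containing two contact discontinuities $J_1$, $J_2$ (given in the context) of the Riemann problem $$\rho_t+(\rho u)_x=0,\qquad \Big(\rho\big(u-\tfrac{A}{\rho}\big)\Big)_t+\Big(\rho u\big(u-\tfrac{A}{\rho}\big)\Big)_x=\beta\rho,$$ $$(\rho,u)(x,0)=(\rho_-,u_-)\ (x<0),\qquad (\rho,u)(x,0)=(\rho_+,u_+)\ (x>0).$$ Then, as $A\to A_0$ (with $A_0<A<A_1$), $(\rho^A,u^A)$ converges, in the sense of distributions (as specified in the context), to the delta shock wave solution of the same Riemann problem with $A=A_0$.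
   Context: Two-contact solution. If $u_+>u_--\frac{A}{\rho_-}$, the Riemann solution is $$(\rho,u)(x,t)=\begin{cases}(\rho_-,u_-+\beta t), & x<x_1(t),\\(\rho_*,v_*+\beta t), & x_1(t)<x<x_2(t),\\(\rho_+,u_++\beta t), & x>x_2(t),\end{cases}$$ where $v_*=u_+$, $\frac{A}{\rho_*}=u_+-u_-+\frac{A}{\rho_-}$, $x_1(t)=(u_--\frac{A}{\rho_-})t+\frac12\beta t^2$ (the contact discontinuity $J_1$), and $x_2(t)=u_+t+\frac12\beta t^2$ (the contact discontinuity $J_2$). Delta shock wave solution. If $u_+\le u_--\frac{A}{\rho_-}$, the Riemann solution is the delta shock wave solution $$(\rho,u)(x,t)=\begin{cases}(\rho_-,u_-+\beta t), & x<x(t),\\(w(t)\delta(x-x(t)),u_\delta(t)), & x=x(t),\\(\rho_+,u_++\beta t), & x>x(t),\end{cases}$$ with $u_\delta(t)=v_\delta+\beta t$, $x(t)=v_\delta t+\frac12\beta t^2$, $w(t)=w_0t$, where $$w_0=\sqrt{\rho_+\rho_-(u_+-u_-)\Big((u_+-u_-)-\Big(\frac{A}{\rho_+}-\frac{A}{\rho_-}\Big)\Big)},$$ $v_\delta=\frac{\rho_+u_+-\rho_-u_-+w_0}{\rho_+-\rho_-}$ if $\rho_+\ne\rho_-$, and $v_\delta=\frac12\big(u_++u_--\frac{A}{\rho_-}\big)$ if $\rho_+=\rho_-$ (in which case $w_0=\rho_-u_--\rho_+u_+$). For $A=A_0$ one has $u_+=u_--\frac{A_0}{\rho_-}$, so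 the solution is of this type. For the delta shock wave solution, $\rho$ and $\rho u$ denote the distributions $$\langle\rho,\psi\rangle=\iint\hat\rho\psi\,dxdt+\int_0^\infty w(t)\psi(x(t),t)dt,\qquad \langle\rho u,\psi\rangle=\iint\hat\rho u\psi\,dxdt+\int_0^\infty w(t)u_\delta(t)\psi(x(t),t)dt,$$ where $\hat\rho=\rho_-$ for $x<x(t)$, $\hat\rho=\rho_+$ for $x>x(t)$, and the double integrals are over $\mathbb{R}\times(0,\infty)$. Convergence of $(\rho^A,u^A)$ to a delta shock wave solution means: $\rho^A\to\rho$, $\rho^Au^A\to\rho u$ and $u^A\to u$ in the sense of distributions on $\mathbb{R}\times(0,\infty)$ (where $u$ is identified with its a.e.-defined function). *)

(* Defs.v *)
From HB Require Import structures.
From mathcomp Require Import all_boot all_order all_algebra.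
From mathcomp Require Import all_classical all_reals all_analysis.

Set Implicit Arguments.
Unset Strict Implicit.
Unset Printing Implicit Defensive.

Import Order.TTheory GRing.Theory Num.Theory.
Import numFieldNormedType.Exports.

Local Open Scope classical_set_scope.
Local Open Scope ring_scope.

(* A point p : R * R of space-time is (x, t) = (p.1, p.2). *)

Definition upper_half_plane {R : realType} : set (R * R) :=
  [set p | 0 < p.2].

Fixpoint is_Ck {R : realType} (k : nat) (f : R * R -> R) : Prop :=
  continuous f /\
  if k is k'.+1 then
    [/\ forall p, derivable f p (1, 0), is_Ck k' (fun p => 'D_(1, 0) f p),
        forall p, derivable f p (0, 1) & is_Ck k' (fun p => 'D_(0, 1) f p)]
  else True.

Definition is_smooth {R : realType} (f : R * R -> R) : Prop :=
  forall k, is_Ck k f.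

Definition tsupport {R : realType} (f : R * R -> R) : set (R * R) :=
  closure [set p | f p != 0].

(* A test function on the open half-plane is identified with its extension
   by zero, which is a smooth function on the whole plane. *)
Definition is_test_function {R : realType} (psi : R * R -> R) : Prop :=
  [/\ is_smooth psi, compact (tsupport psi) &
      tsupport psi `<=` upper_half_plane].

Definition functional (R : realType) : Type := (R * R -> R) -> R.

Definition regular_distribution {R : realType} (f : R * R -> R) :
    functional R := fun psi =>
  \int[(@lebesgue_measure R \x @lebesgue_measure R)%E]_(p in upper_half_plane)
    (f p * psi p).

Definition curve_distribution {R : realType} (w x : R -> R) :
    functional R := fun psi =>
  \int[@lebesgue_measure R]_(t in `]0, +oo[) (w t * psi (x t, t)).

Definition cvg_distribution {R : realType} (F : set_system R)
    (T : R -> functional R) (T0 : functional R) : Prop :=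
  forall psi, is_test_function psi -> T A psi @[A --> F] --> T0 psi.

Section two_contact_solution.
Context {R : realType} (beta rhom rhop um up A : R).

(* Solves A / rho_star = up - um + A / rhom. *)
Definition rho_star : R := A / (up - um + A / rhom).
Definition v_star : R := up.
Definition J1 (t : R) : R := (um - A / rhom) * t + 2^-1 * beta * t ^+ 2.
Definition J2 (t : R) : R := up * t + 2^-1 * beta * t ^+ 2.

(* The values on the (Lebesgue-null) curves J1 and J2 are a convention. *)
Definition contact_rho (p : R * R) : R :=
  if p.1 < J1 p.2 then rhom
  else if p.1 < J2 p.2 then rho_star
  else rhop.

Definition contact_u (p : R * R) : R :=
  if p.1 < J1 p.2 then um + beta * p.2
  else if p.1 < J2 p.2 then v_star + beta * p.2
  else up + beta * p.2.

End two_contact_solution.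

Section delta_shock_solution.
Context {R : realType} (beta rhom rhop um up A : R).

(* When rhop = rhom and up < um this equals rhom * um - rhop * up. *)
Definition w0 : R :=
  Num.sqrt (rhop * rhom * (up - um) *
            ((up - um) - (A / rhop - A / rhom))).

Definition v_delta : R :=
  if rhop == rhom then 2^-1 * (up + um - A / rhom)
  else (rhop * up - rhom * um + w0) / (rhop - rhom).

Definition w_delta (t : R) : R := w0 * t.
Definition u_delta (t : R) : R := v_delta + beta * t.
Definition x_delta (t : R) : R := v_delta * t + 2^-1 * beta * t ^+ 2.

(* The absolutely continuous part of the density; its value on the curve
   x = x_delta t is a convention. *)
Definition delta_rho_hat (p : R * R) : R :=
  if p.1 < x_delta p.2 then rhom else rhop.

Definition delta_u (p : R * R) : R :=
  if p.1 < x_delta p.2 then um + beta * p.2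
  else if p.1 == x_delta p.2 then u_delta p.2
  else up + beta * p.2.

Definition delta_rho_distribution : functional R := fun psi =>
  regular_distribution delta_rho_hat psi +
  curve_distribution w_delta x_delta psi.

Definition delta_rhou_distribution : functional R := fun psi =>
  regular_distribution (fun p => delta_rho_hat p * delta_u p) psi +
  curve_distribution (fun t => w_delta t * u_delta t) x_delta psi.

End delta_shock_solution.

(* Main.v *)
Require Import Defs.
From HB Require Import structures.
From mathcomp Require Import all_boot all_order all_algebra.
From mathcomp Require Import all_classical all_reals all_analysis.
From mathcomp Require Import measurable_realfun ring lra.

Set Implicit Arguments.
Unset Strict Implicit.
Unset Printing Implicit Defensive.

Import Order.TTheory GRing.Theory Num.Theory.
Import numFieldNormedType.Exports.
Local Open Scope classical_set_scope.
Local Open Scope ring_scope.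

(** At the critical value A0 = rho_- (u_- - u_+) the constants of the delta
    shock become explicit: w0 = A0 and v_delta = u_+ (lemmas [w0_critical] and
    [v_delta_critical]), so the delta shock travels along the same parabola
    x = X(t) = u_+ t + beta t^2 / 2 as the second contact J2.  Put
    e = u_+ - u_- + A / rho_- = (A - A0) / rho_-.  The first contact is
    J1(t) = X(t) - e t, hence the intermediate state occupies the thin fan
    X(t) - e t <= x < X(t), and all the dependence on A sits in this fan and in
    the value taken there.

    Since rho_* = A / e = rho_- + A0 / e, each of the three quantities rho,
    rho u and u equals, inside the fan, its left state a(t) plus a correction
    of the form g0(t) / e + g1(t) with g0, g1 independent of A:
      - for rho:    g0 = A0,                     g1 = 0;
      - for rho u:  g0 = A0 (u_+ + beta t),      g1 = - A0;
      - for u:      g0 = 0,                      g1 = u_+ - u_-.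
    Tested against psi, the quantity therefore differs from its two-state limit
    (left state for x < X(t), right state beyond) by the integral over the fan
    of (g0 / e + g1) psi.

    The analytic core is [fan_average]: for phi continuous with bounded
    support, 1/e times the integral of phi over the fan tends to the integral
    over t > 0 of t phi(X(t), t) when e -> 0+, because the fan has width e t at
    time t and phi is uniformly close to phi(X(t), t) on it.  So the g0 / e term
    produces a Dirac mass on the curve with weight t g0(t), and the g1 term,
    which lacks the factor 1/e, disappears ([three_state_cvg]).  With the
    values of g0 above, the weights are w0 t, w0 t (u_+ + beta t) and 0, which
    are those of the delta shock solution. *)

Section fan_concentration.
Context {R : realType}.
Local Notation mu := (@lebesgue_measure R).
Local Notation mu2 := (mu \x mu)%E.
(* The product whose sigma-algebra is literally the one carried by mu2. *)
Local Notation plane := (measurableTypeR R * measurableTypeR R)%type.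

(** * Borel sets of the plane and continuous functions of bounded support *)

(** The Euclidean topology is second countable, so an open set is a countable
    union of measurable rectangles.  Here only the x-side of the rectangles is
    given rational data; the t-side is the open set of times for which the whole
    x-interval stays in U. *)
Lemma open_measurable_plane (U : set (R * R)) :
  open U -> measurable (U : set plane).
Proof.
move=> oU.
pose V (q r : rat) : set R :=
  [set t | forall x : R, x \in `]ratr q - ratr r, ratr q + ratr r[ -> U (x, t)]^°.
have -> : U = \bigcup_q \bigcup_r
    (`]ratr q - ratr r, ratr q + ratr r[%classic `*` V q r).
  apply/seteqP; split => [[x t] Uxt|[x t] [q _ [r _ []]]] /=; last first.
    by move=> xq /interior_subset; exact.
  have /nbhs_ballP[e /= e0 eU] : nbhs (x, t) U by exact: open_nbhs_nbhs.
  have /rat_in_itvoo[r] : 0 < e / 2 by rewrite divr_gt0.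
  rewrite in_itv/= => /andP[r0 re].
  have /rat_in_itvoo[q] : x - ratr r < x + ratr r by lra.
  rewrite in_itv/= => /andP[xq qx].
  exists q => //; exists r => //; split => /=.
    by rewrite in_itv/=; apply/andP; split; lra.
  apply/nbhs_ballP; exists e => //= s ts y.
  rewrite in_itv/= => /andP[y1 y2]; apply: eU; split => //=.
  by rewrite /ball/= ltr_norml; apply/andP; split; lra.
apply: bigcupT_measurable_rat => q; apply: bigcupT_measurable_rat => r.
apply: measurableX; first exact: measurable_itv.
by apply: open_measurable; exact: open_interior.
Qed.

Lemma continuous_measurable_plane (f : R * R -> R) :
  continuous f -> measurable_fun (setT : set plane) f.
Proof.
move=> cf; apply: (measurability _ (RGenOpens.measurableE R)) => _ [_ [a [b ->] <-]].
rewrite setTI; apply: open_measurable_plane.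
by apply: open_comp => //; exact: interval_open.
Qed.

Definition square (M : R) : set (R * R) :=
  `[- M, M]%classic `*` `[- M, M]%classic.

Lemma square_compact M : compact (square M).
Proof. by apply: compact_setX; exact: segment_compact. Qed.

Lemma square_measurable M : measurable (square M : set plane).
Proof. by apply: measurableX; exact: measurable_itv. Qed.

Lemma square_finite M : (mu2 (square M) < +oo)%E.
Proof.
rewrite product_measure1E//.
have fin : mu `[- M, M]%classic \is a fin_num.
  by rewrite lebesgue_measure_itv/=; case: ifP.
by rewrite lte_mul_pinfty// ?ltey_eq ?fin.
Qed.

Lemma continuous_integrable_square (f : R * R -> R) M D :
  continuous f -> measurable (D : set plane) -> D `<=` square M ->
  mu2.-integrable D (EFin \o f).
Proof.
move=> cf mD DM; apply: (integrableS (square_measurable M)) => //.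
apply: measurable_bounded_integrable; first exact: square_measurable.
- exact: square_finite.
- exact: measurable_funTS (continuous_measurable_plane cf).
- have cB : compact (f @` square M).
    apply: (continuous_compact _ (@square_compact M)).
    exact: continuous_subspaceT.
  have [K [Kr fK]] := @compact_bounded R R^o _ cB.
  exists K; split => // k /fK kf p pM.
  by apply: kf; exists p.
Qed.

(** The form in which test functions are used: the domain D may be unbounded,
    the bounded support alone makes the integral finite. *)
Lemma continuous_integrable (f : R * R -> R) M D :
  continuous f -> (forall p, f p != 0 -> square M p) ->
  measurable (D : set plane) ->
  mu2.-integrable D (EFin \o f).
Proof.
move=> cf fM mD; apply: (@integrableS _ plane _ mu2 setT D) => //.
have -> : EFin \o f = (EFin \o f) \_ (square M).
  apply/funext => p /=; rewrite patchE; case: ifPn => // /negP pM.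
  by have [->//|/fM fp] := eqVneq (f p) 0; case: pM; apply/mem_set.
apply: (integrable_mkcond (mu := mu2) (EFin \o f) (square_measurable M)).1.
by apply: (@continuous_integrable_square f M) => //; exact: square_measurable.
Qed.

Lemma upper_half_plane_measurable :
  measurable (@upper_half_plane R : set plane).
Proof.
apply: open_measurable_plane; apply: (@open_comp _ _ snd (fun t : R => 0 < t)).
  by move=> p _; exact: cvg_snd.
exact: open_gt.
Qed.

(** Piecewise continuous integrands are handled as sums of cut-offs f \_ P. *)
Lemma restrict_integrable (f : R * R -> R) M (P D : set (R * R)) :
  continuous f -> (forall p, f p != 0 -> square M p) ->
  measurable (P : set plane) -> measurable (D : set plane) ->
  mu2.-integrable D (EFin \o (f \_ P)).
Proof.
move=> cf fM mP mD; apply: (@integrableS _ plane _ mu2 setT D) => //.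
rewrite -restrict_EFin.
by apply: (integrable_mkcond (mu := mu2) (EFin \o f) mP).1;
  exact: continuous_integrable cf fM mP.
Qed.

Lemma restrict_bool T (f : T -> R) (b : pred T) :
  f \_ [set x | b x] = fun x => if b x then f x else 0.
Proof.
apply/funext => x; rewrite patchE; congr (if _ then _ else _).
by apply/idP/idP => [/set_mem|/mem_set].
Qed.

(** Allows unbounded domains of integration to be truncated outside the support
    of the integrand. *)
Lemma eq_Rintegral_support d (T : measurableType d) (m : {measure set T -> \bar R})
    (D E : set T) (f : T -> R) : (forall x, f x != 0 -> D x <-> E x) ->
  \int[m]_(x in D) f x = \int[m]_(x in E) f x.
Proof.
move=> fDE; rewrite Rintegral_mkcond [RHS]Rintegral_mkcond.
congr (Rintegral _ _ _); apply/funext => x; rewrite !patchE.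
have [->|/fDE DE] := eqVneq (f x) 0; first by rewrite !if_same.
by congr (if _ then _ else _); apply/idP/idP => /set_mem/DE/mem_set.
Qed.

(** * Concentration of the integral over a shrinking fan *)

(** The region swept by the intermediate state when e measures the difference
    of the speeds of the two contacts and X is the right one. *)
Definition fan (X : R -> R) (e : R) : set (R * R) :=
  [set p | X p.2 - e * p.2 <= p.1 < X p.2].

Definition strip (M : R) : set (R * R) := [set p | p.2 \in `]0, M]].

Lemma measurable_below (X : R -> R) : continuous X ->
  measurable ([set p | p.1 < X p.2] : set plane).
Proof.
move=> cX; pose h p : R := X p.2 - p.1.
have ch : continuous h.
  move=> p; apply: cvgB; last exact: cvg_fst.
  by apply: continuous_comp; [exact: cvg_snd|exact: cX].
have -> : [set p | p.1 < X p.2] = h @^-1` [set y | 0 < y].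
  by apply/seteqP; split => p /=; rewrite subr_gt0.
apply: open_measurable_plane; apply: open_comp; last exact: open_gt.
by move=> p _; exact: ch.
Qed.

Lemma fan_measurable X e : continuous X -> measurable (fan X e : set plane).
Proof.
move=> cX.
have -> : fan X e = [set p | p.1 < X p.2] `\` [set p | p.1 < X p.2 - e * p.2].
  apply/seteqP; split => p; rewrite /fan/= leNgt; first by case/andP=> /negP.
  by move=> [-> /negP->].
apply: measurableD; first exact: measurable_below.
apply: (@measurable_below (fun t => X t - e * t)) => t.
by apply: cvgB; [exact: cX|exact: mulrl_continuous].
Qed.

Lemma strip_measurable M : measurable (strip M : set plane).
Proof.
have -> : strip M = setT `*` `]0, M]%classic.
  by apply/seteqP; split => [[x t]|[x t] []].
by apply: measurableX => //; exact: measurable_itv.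
Qed.

Lemma fan_bounded X e M : continuous X -> e <= 1 ->
  exists N, fan X e `&` strip M `<=` square N.
Proof.
move=> cX e1.
have cB : compact (X @` `[0, M]).
  apply: continuous_compact; last exact: segment_compact.
  exact: continuous_subspaceT.
have [K [Kr XK]] := @compact_bounded R R^o _ cB.
exists (`|K| + 1 + `|M|) => -[x t] [] /andP[/= x1 x2].
rewrite /strip/= in_itv/= => /andP[t0 tM].
have : `|X t| <= `|K| + 1.
  apply: XK; first by rewrite ltr_pwDr// ler_norm.
  by exists t => //=; rewrite in_itv/= (ltW t0).
rewrite ler_norml => /andP[X1 X2].
have := ler_norm M; have := normr_ge0 M; have := normr_ge0 K => K0 M0 MM.
(* With e <= 1 the fan stays within M of the curve over ]0, M]. *)
have et : e * t <= t by rewrite ler_piMl// ltW.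
split; rewrite /= in_itv/=; apply/andP; split; lra.
Qed.

(** The section of the fan at time t is an interval of length e t, so Fubini
    turns the fan integral of a function of time into a one-dimensional one. *)
Lemma fan_integral X e M (g : R -> R) : continuous X -> continuous g ->
    0 < e <= 1 ->
  \int[mu2]_(p in fan X e `&` strip M) g p.2 =
  \int[mu]_(t in `]0, M]) (e * t * g t).
Proof.
move=> cX cg /andP[e0 e1].
set D := fan X e `&` strip M.
have mD : measurable (D : set plane).
  by apply: measurableI; [exact: fan_measurable|exact: strip_measurable].
have [N DN] := fan_bounded M cX e1.
have cg2 : continuous (fun p : R * R => g p.2).
  by move=> p; apply: continuous_comp; [exact: cvg_snd|exact: cg].
have := continuous_integrable_square cg2 mD DN.
move/(integrable_mkcond _ mD) => iD.
congr fine; rewrite integral_mkcond -integral21_prod_meas1//.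
rewrite [RHS]integral_mkcond; apply: eq_integral => t _; rewrite /fubini_G.
rewrite patchE; case: ifPn => tM; last first.
  rewrite integral0_eq// => x _; rewrite patchE ifF//.
  by apply/negP => /set_mem[_ /mem_set]; exact/negP.
have -> : (fun x => ((EFin \o (fun p : R * R => g p.2)) \_ D) (x, t)) =
          cst (g t)%:E \_ `[X t - e * t, X t[%classic.
  apply/funext => x; rewrite !patchE /=; congr (if _ then _ else _).
  apply/idP/idP => /set_mem xt; apply/mem_set.
    by case: xt => + _; rewrite /fan/= in_itv.
  by split; [move: xt; rewrite /fan/= in_itv|exact: set_mem tM].
move/set_mem: tM; rewrite /= in_itv/= => /andP[t0 tM].
have L : mu `[X t - e * t, X t[%classic = (e * t)%:E.
  rewrite lebesgue_measure_itv/= lte_fin ltrBlDr ltrDl mulr_gt0//.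
  by rewrite -EFinD; congr EFin; ring.
by rewrite -integral_mkcond integral_cst// [X in (_ * X)%E]L -EFinM mulrC.
Qed.

(** Uniformity in t comes from compactness of [0, M], used as near-covering:
    around each s, continuity of phi at (X s, s) and of X at s controls all
    (x, t) of the fan with t close to s, once e (|s| + 1) is small. *)
Lemma fan_uniform (phi : R * R -> R) (X : R -> R) M eps :
    continuous phi -> continuous X -> 0 < eps ->
  \forall e \near 0^'+, forall p, (fan X e `&` strip M) p ->
    `|phi p - phi (X p.2, p.2)| <= eps.
Proof.
move=> cphi cX eps0.
pose Q (e t : R) := forall x, X t - e * t <= x < X t ->
  0 <= t -> `|phi (x, t) - phi (X t, t)| <= eps.
have /compact_near_coveringP/(_ R 0^'+ Q _) cov := @segment_compact R 0 M.
suff : \forall e \near 0^'+, `[0, M]%classic `<=` Q e.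
  apply: filterS => e eQ [x t] [] xt /=; rewrite /strip/= in_itv/= => /andP[t0 tM].
  by apply: (eQ t) => //=; rewrite ?in_itv/= ltW.
apply: cov => s _.
have /cvgrPdist_le/(_ _ (divr_gt0 eps0 (ltr0Sn R 1))) := cphi (X s, s).
move=> /nbhs_ballP[d /= d0 phid].
have d20 : 0 < d / 2 by rewrite divr_gt0.
have S0 : 0 < `|s| + 1 by rewrite ltr_wpDl.
exists ([set t | `|X s - X t| < d / 2 /\ `|s - t| < Num.min d 1],
        [set e | 0 < e < d / 2 / (`|s| + 1)]); first split => /=.
- apply: filterI; first by have /cvgrPdist_lt/(_ _ d20) := cX s.
  by apply/nbhs_ballP; exists (Num.min d 1); rewrite /= ?lt_min ?d0 ?ltr01.
- near=> e; apply/andP; split; near: e; first exact: nbhs_right_gt.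
  by apply: nbhs_right_lt; rewrite divr_gt0.
move=> [t e] /= [[Xst]]; rewrite lt_min => /andP[std st1] /andP[e0].
rewrite ltr_pdivlMr// => es x /andP[x1 x2] t0.
have et : e * t < d / 2.
  apply: le_lt_trans es; rewrite ler_wpM2l ?(ltW e0)//.
  have := ler_norm s; move: st1; rewrite ltr_norml => /andP[? ?]; lra.
have q1 : `|phi (X s, s) - phi (x, t)| <= eps / 2.
  apply: phid; split => //=; rewrite /ball/= ltr_norml.
  by move: Xst; rewrite ltr_norml => /andP[? ?]; apply/andP; split; lra.
have q2 : `|phi (X s, s) - phi (X t, t)| <= eps / 2.
  apply: phid; split => //=; rewrite /ball/= (lt_trans Xst)//; lra.
by rewrite (le_trans (ler_distD (phi (X s, s)) _ _))// distrC; lra.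
Unshelve. all: by end_near.
Qed.

(** By [fan_integral], replacing phi by its value on the curve gives exactly
    the limit for every e; by [fan_uniform] this replacement costs at most a
    small multiple of the area e C of the truncated fan, and the factor 1/e
    compensates this area. *)
Lemma fan_average (phi : R * R -> R) (X : R -> R) M :
    continuous phi -> (forall p, phi p != 0 -> square M p) -> continuous X ->
  e^-1 * (\int[mu2]_(p in upper_half_plane `&` fan X e) phi p)
    @[e --> 0^'+] -->
  \int[mu]_(t in `]0, +oo[) (t * phi (X t, t)).
Proof.
move=> cphi phiM cX.
pose g t := phi (X t, t).
have cg : continuous g.
  move=> t; apply: (@continuous_comp _ _ _ (fun t => (X t, t)) phi); last exact: cphi.
  exact: (cvg_pair (F := nbhs t) (G := nbhs (X t)) (H := nbhs t) (cX t) cvg_id).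
have phi_le x t : phi (x, t) != 0 -> t <= M.
  by move/phiM => -[_ /=]; rewrite in_itv/= => /andP[].
have -> : \int[mu]_(t in `]0, +oo[) (t * phi (X t, t)) =
          \int[mu]_(t in `]0, M]) (t * g t).
  apply: eq_Rintegral_support => t; rewrite mulf_eq0 negb_or => /andP[_].
  move/phi_le => tM; rewrite /= !in_itv/= andbT tM andbT; exact: iff_refl.
have phiE e : \int[mu2]_(p in upper_half_plane `&` fan X e) phi p =
              \int[mu2]_(p in fan X e `&` strip M) phi p.
  apply: eq_Rintegral_support => -[x t] /phi_le tM.
  rewrite setIC /fan /strip /upper_half_plane /= in_itv/= tM andbT.
  exact: iff_refl.
have ig0 (h : R -> R) : continuous h ->
    mu.-integrable `]0, M] (EFin \o (fun t => t * h t)).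
  move=> ch; apply: (@integrableS _ (measurableTypeR R) R mu `[0, M]%classic) => //.
    exact: subset_itv_oc_cc.
  apply: continuous_compact_integrable; first exact: segment_compact.
  by apply: continuous_subspaceT => t; apply: cvgM; [exact: cvg_id|exact: ch].
pose C : R := \int[mu]_(t in `]0, M]) (t * 1).
have C0 : 0 <= C.
  by apply: Rintegral_ge0 => t /=; rewrite in_itv/= mulr1 => /andP[/ltW].
have ccst (k : R) : continuous (fun _ : R => k) by move=> ?; exact: cvg_cst.
apply/cvgrPdist_le => eps eps0.
(* C + 1 rather than C, because C may vanish (when M <= 0). *)
have C1 : 0 < C + 1 by rewrite ltr_wpDl.
have [eC0 eC] : 0 < eps / (C + 1) /\ eps / (C + 1) * C <= eps.
  split; first exact: divr_gt0.
  by rewrite mulrAC ler_pdivrMr// ler_pM2l// lerDl.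
near=> e.
have e0 : 0 < e by near: e; exact: nbhs_right_gt.
have e1 : e <= 1 by near: e; exact: nbhs_right_le.
have unif p : (fan X e `&` strip M) p -> `|phi p - g p.2| <= eps / (C + 1).
  by move: p; near: e; exact: fan_uniform.
set D := fan X e `&` strip M.
have mD : measurable (D : set plane).
  by apply: measurableI; [exact: fan_measurable|exact: strip_measurable].
have [N DN] := fan_bounded M cX e1.
have iD (f : R * R -> R) : continuous f -> mu2.-integrable D (EFin \o f).
  by move=> cf; exact: continuous_integrable_square cf mD DN.
have cg2 : continuous (fun p : R * R => g p.2).
  by move=> p; apply: continuous_comp; [exact: cvg_snd|exact: cg].
have cd : continuous (fun p : R * R => g p.2 - phi p).
  by move=> p; apply: cvgB; [exact: cg2|exact: cphi].
have fanE (h : R -> R) : continuous h ->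
    \int[mu2]_(p in D) h p.2 = e * \int[mu]_(t in `]0, M]) (t * h t).
  move=> ch; rewrite fan_integral ?e0//.
  under eq_Rintegral do rewrite -mulrA.
  by rewrite RintegralZl//; exact: ig0.
rewrite phiE -(mulKf (lt0r_neq0 e0) (\int[mu]_(t in _) _)) -fanE//.
rewrite -mulrBr -RintegralB//; [|exact: iD|exact: iD].
rewrite normrM gtr0_norm ?invr_gt0//.
rewrite ler_pdivrMl//.
apply: le_trans (le_normr_Rintegral mD (iD _ cd)) _.
apply: le_trans (_ : \int[mu2]_(p in D) (eps / (C + 1)) <= _).
  apply: le_Rintegral => //; [|by apply: iD => p; exact: cvg_cst|].
    by apply: (iD (fun p => `|g p.2 - phi p|)) => p; apply: cvg_norm; exact: cd.
  by move=> p Dp; rewrite distrC unif.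
rewrite (fanE (fun=> eps / (C + 1)))// ler_wpM2l ?(ltW e0)//.
under eq_Rintegral do rewrite -[X in X * _]mulr1.
by rewrite RintegralZr// 1?mulrC//; exact: (ig0 (fun=> 1)).
Unshelve. all: by end_near.
Qed.

(** * Collapse of three-state profiles onto a Dirac mass *)

Definition two_state (X a c : R -> R) (p : R * R) : R :=
  if p.1 < X p.2 then a p.2 else c p.2.

Definition three_state (X : R -> R) (e : R) (a b c : R -> R) (p : R * R) : R :=
  if p.1 < X p.2 - e * p.2 then a p.2
  else if p.1 < X p.2 then b p.2 else c p.2.

Section testing.
Variables (psi : R * R -> R) (M : R).
Hypotheses (cpsi : continuous psi) (psiM : forall p, psi p != 0 -> square M p).
Variable X : R -> R.
Hypothesis cX : continuous X.

Let ctime (h : R -> R) : continuous h -> continuous (fun p : R * R => h p.2 * psi p).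
Proof.
move=> ch p; apply: cvgM; last exact: cpsi.
by apply: continuous_comp; [exact: cvg_snd|exact: ch].
Qed.

Let timeM (h : R -> R) p : h p.2 * psi p != 0 -> square M p.
Proof. by rewrite mulf_eq0 negb_or => /andP[_ /psiM]. Qed.

Lemma two_state_integrable (a c : R -> R) : continuous a -> continuous c ->
  mu2.-integrable upper_half_plane (EFin \o (fun p => two_state X a c p * psi p)).
Proof.
move=> ca cc.
have cac : continuous (fun t => a t - c t).
  by move=> t; apply: cvgB; [exact: ca|exact: cc].
have mH := upper_half_plane_measurable.
pose d := (fun p => (a p.2 - c p.2) * psi p) \_ [set p | p.1 < X p.2].
have -> : EFin \o (fun p => two_state X a c p * psi p) =
          (EFin \o (fun p => c p.2 * psi p)) \+ (EFin \o d).
  apply/funext => p; rewrite /= -EFinD; congr EFin.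
  rewrite /d restrict_bool /two_state; case: ifPn => _; first by rewrite /=; ring.
  by rewrite addr0.
apply: integrableD => //.
  exact: continuous_integrable (ctime cc) (@timeM c) mH.
apply: restrict_integrable (ctime cac) (@timeM _) _ mH.
exact: measurable_below.
Qed.

(** The left state is the reference inside the fan: there the limiting profile
    equals a, so the defect is b - a. *)
Lemma three_state_split e (a b c : R -> R) : 0 <= e ->
  continuous a -> continuous b -> continuous c ->
  regular_distribution (three_state X e a b c) psi =
  regular_distribution (two_state X a c) psi +
  \int[mu2]_(p in upper_half_plane `&` fan X e) ((b p.2 - a p.2) * psi p).
Proof.
move=> e0 ca cb cc.
have cba : continuous (fun t => b t - a t).
  by move=> t; apply: cvgB; [exact: cb|exact: ca].
have mH := upper_half_plane_measurable.
rewrite /regular_distribution Rintegral_mkcondr -RintegralD//.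
- apply: eq_Rintegral => p /set_mem; rewrite /upper_half_plane /= => t0.
  rewrite /fan restrict_bool /three_state /two_state leNgt.
  have et : 0 <= e * p.2 by rewrite mulr_ge0// ltW.
  have [x1|x1] := ltP p.1 (X p.2 - e * p.2) => /=.
    by rewrite ifT ?addr0//; lra.
  by case: ifPn => _ ; rewrite ?addr0//; ring.
- exact: two_state_integrable.
- apply: restrict_integrable (ctime cba) (@timeM _) _ mH.
  exact: fan_measurable.
Qed.

(** A middle state that blows up like g0 / e leaves a Dirac mass of weight
    t g0(t) on the limiting curve, while its bounded part g1 leaves nothing:
    with I(g) the average of [fan_average] for phi = g psi, the defect of
    [three_state_split] is I(g0) + e I(g1), and both averages converge.  The
    profile is prescribed only eventually along F because the formula for the
    middle state makes sense only where e does not vanish. *)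
Lemma three_state_cvg (F : set_system R) {FF : Filter F} (e a c g0 g1 : R -> R)
    (f : R -> R * R -> R) :
  continuous a -> continuous c -> continuous g0 -> continuous g1 ->
  e A @[A --> F] --> 0^'+ ->
  (\forall A \near F, f A =
    three_state X (e A) a (fun t => a t + (e A)^-1 * g0 t + g1 t) c) ->
  regular_distribution (f A) psi @[A --> F] -->
  regular_distribution (two_state X a c) psi +
    curve_distribution (fun t => t * g0 t) X psi.
Proof.
move=> ca cc cg0 cg1 e0 fE.
pose I (g : R -> R) A : R := (e A)^-1 *
  (\int[mu2]_(p in upper_half_plane `&` fan X (e A)) (g p.2 * psi p)).
pose J (g : R -> R) : R := \int[mu]_(t in `]0, +oo[) (t * (g t * psi (X t, t))).
have IJ (g : R -> R) : continuous g -> I g A @[A --> F] --> J g.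
  move=> cg; have := fan_average (ctime cg) (@timeM g) cX.
  exact: cvg_comp e0.
have eR : e A @[A --> F] --> (0 : R).
  by apply: (cvg_trans e0); exact: cvg_within.
have egt0 : \forall A \near F, 0 < e A by exact: (e0 _ (nbhs_right_gt 0)).
have -> : curve_distribution (fun t => t * g0 t) X psi = J g0 + 0 * J g1.
  rewrite mul0r addr0; apply: eq_Rintegral => t _; exact: esym (mulrA _ _ _).
apply: cvg_trans (_ : (regular_distribution (two_state X a c) psi +
  (I g0 A + e A * I g1 A)) @[A --> F] --> _); last first.
  apply: cvgD; first exact: cvg_cst.
  by apply: cvgD; [exact: IJ|apply: cvgM => //; exact: IJ].
apply: near_eq_cvg; near=> A.
have eA : 0 < e A by near: A; exact: egt0.
have -> : f A = three_state X (e A) a (fun t => a t + (e A)^-1 * g0 t + g1 t) c.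
  by near: A.
have cb : continuous (fun t => a t + (e A)^-1 * g0 t + g1 t).
  move=> t; apply: cvgD; last exact: cg1.
  by apply: cvgD; [exact: ca|apply: cvgM; [exact: cvg_cst|exact: cg0]].
rewrite three_state_split ?ltW//; congr (_ + _).
have mD : measurable (upper_half_plane `&` fan X (e A) : set plane).
  by apply: measurableI; [exact: upper_half_plane_measurable|exact: fan_measurable].
have iD (g : R -> R) : continuous g ->
    mu2.-integrable (upper_half_plane `&` fan X (e A)) (EFin \o (fun p => g p.2 * psi p)).
  by move=> cg; exact: continuous_integrable (ctime cg) (@timeM g) mD.
rewrite /I mulrA divff ?gt_eqF// mul1r -RintegralZl//; last exact: iD.
rewrite -RintegralD//; last 2 first.
- have cg : continuous (fun t => (e A)^-1 * g0 t).
    by move=> t; apply: cvgM; [exact: cvg_cst|exact: cg0].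
  by under eq_fun do rewrite mulrA; exact: iD cg.
- exact: iD.
by apply: eq_Rintegral => p _; ring.
Unshelve. all: by end_near.
Qed.
End testing.

End fan_concentration.

(** * The Riemann problem at the critical value of A *)

Section critical_riemann_problem.
Context {R : realType}.

Lemma affine_continuous (k b : R) : continuous (fun t : R => k + b * t).
Proof. by move=> t; apply: cvgD; [exact: cvg_cst|exact: mulrl_continuous]. Qed.

Lemma J2_continuous (beta up : R) : continuous (J2 beta up).
Proof.
move=> t; apply: cvgD; first exact: mulrl_continuous.
by apply: cvgM; [exact: cvg_cst|exact: exprn_continuous].
Qed.

Lemma bounded_support (psi : R * R -> R) : compact (tsupport psi) ->
  exists M, forall p, psi p != 0 -> square M p.
Proof.
move=> cK; have [K [Kr psiK]] := @compact_bounded R (R^o * R^o)%type _ cK.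
exists (`|K| + 1) => p psip.
have : `|p| <= `|K| + 1.
  apply: psiK; first by rewrite ltr_pwDr// ler_norm.
  exact: subset_closure.
rewrite prod_normE ge_max !ler_norml => /andP[p1 p2].
by split; rewrite /= in_itv.
Qed.

(** At A = rho_- (u_- - u_+) the second factor under the root collapses to
    - A / rho_+, and the radicand becomes A squared. *)
Lemma w0_critical (rhom rhop um up : R) : 0 < rhom -> 0 < rhop -> up < um ->
  w0 rhom rhop um up (rhom * (um - up)) = rhom * (um - up).
Proof.
move=> m0 p0 ud; rewrite /w0.
have -> : rhop * rhom * (up - um) * (up - um - (rhom * (um - up) / rhop -
   rhom * (um - up) / rhom)) = (rhom * (um - up)) ^+ 2.
  by field; rewrite !gt_eqF.
by rewrite sqrtr_sqr ger0_norm// mulr_ge0 ?ltW// subr_gt0.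
Qed.

Lemma v_delta_critical (rhom rhop um up : R) : 0 < rhom -> 0 < rhop -> up < um ->
  v_delta rhom rhop um up (rhom * (um - up)) = up.
Proof.
move=> m0 p0 ud; rewrite /v_delta w0_critical//; case: eqVneq => [_|pm].
  by field; rewrite gt_eqF.
by field; rewrite subr_eq0.
Qed.

End critical_riemann_problem.

Theorem theorem4p1 (R : realType) (beta rhom rhop um up A0 A1 : R)
    (rhom_gt0 : 0 < rhom) (rhop_gt0 : 0 < rhop)
    (um_ge0 : 0 <= um) (up_ge0 : 0 <= up) (up_lt_um : up < um)
    (A0E : A0 = rhom * (um - up)) (A0_lt_A1 : A0 < A1)
    (A1P : forall A : R, A0 < A < A1 -> um - A / rhom < up < um) :
  let F : set_system R := within [set A : R | A0 < A < A1] (nbhs A0) in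
  let rho (A : R) := contact_rho beta rhom rhop um up A in
  let u (A : R) := contact_u beta rhom um up A in
  [/\ cvg_distribution F (fun A => regular_distribution (rho A))
        (delta_rho_distribution beta rhom rhop um up A0),
      cvg_distribution F
        (fun A => regular_distribution (fun p => rho A p * u A p))
        (delta_rhou_distribution beta rhom rhop um up A0) &
      cvg_distribution F (fun A => regular_distribution (u A))
        (regular_distribution (delta_u beta rhom rhop um up A0))].
Proof.
move=> F rho u.
(* The difference of the speeds of the two contacts. *)
pose e (A : R) := up - um + A / rhom.
have rhom0 : rhom != 0 by rewrite gt_eqF.
have eE A : e A = (A - A0) / rhom by rewrite A0E /e; field.
have eA0 : e A0 = 0 by rewrite eE subrr mul0r.
have e0 : e A @[A --> F] --> 0^'+.
  have : e A @[A --> A0] --> e A0.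
    by apply: cvgD; [exact: cvg_cst|apply: cvgM; [exact: cvg_id|exact: cvg_cst]].
  rewrite eA0 => ce P /ce; apply: (@filterS _ (nbhs A0)) => A Pe /andP[A0A _].
  by apply: Pe; rewrite eE divr_gt0// subr_gt0.
have near_e : \forall A \near F, 0 < e A by exact: (e0 _ (nbhs_right_gt 0)).
pose X := J2 beta up.
have w0E : w0 rhom rhop um up A0 = A0 by rewrite A0E w0_critical.
have vE : v_delta rhom rhop um up A0 = up by rewrite A0E v_delta_critical.
have xE : x_delta beta rhom rhop um up A0 = X by rewrite /x_delta vE.
have uE : u_delta beta rhom rhop um up A0 = fun t => up + beta * t.
  by rewrite /u_delta vE.
have J1E A : J1 beta rhom um A = fun t => X t - e A * t.
  by apply/funext => t; rewrite /J1 /X /J2 /e; ring.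
(* The blow-up of the intermediate density, with the same numerator A0 for
   every A: this is what makes g0 and g1 below independent of A. *)
have starE A : 0 < e A -> rho_star rhom um up A = rhom + (e A)^-1 * A0.
  move=> eA; have -> : rho_star rhom um up A = A / e A by [].
  rewrite [X in X / _](_ : A = e A * rhom + A0); last by rewrite eE; field.
  by field; rewrite gt_eqF.
have rho_hatE : delta_rho_hat beta rhom rhop um up A0 =
    two_state X (fun=> rhom) (fun=> rhop).
  by rewrite /delta_rho_hat xE.
have delta_uE : delta_u beta rhom rhop um up A0 =
    two_state X (fun t => um + beta * t) (fun t => up + beta * t).
  apply/funext => p; rewrite /delta_u /two_state xE uE.
  (* On the curve itself u_delta coincides with the right state. *)
  by rewrite if_same.
split=> psi [/(_ 0%N) [cpsi _] /bounded_support[M psiM] _].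
- rewrite /delta_rho_distribution rho_hatE xE.
  have -> : w_delta rhom rhop um up A0 = fun t => t * A0.
    by apply/funext => t; rewrite /w_delta w0E mulrC.
  apply: (three_state_cvg (f := rho) cpsi psiM (@J2_continuous R beta up) _ _
    (g0 := fun=> A0) (g1 := fun=> 0) _ _ e0); try exact: cst_continuous.
  near=> A; have eA : 0 < e A by near: A.
  apply/funext => p; rewrite /rho /contact_rho /three_state J1E starE//.
  by rewrite addr0.
- rewrite /delta_rhou_distribution rho_hatE delta_uE xE.
  have -> : (fun t => w_delta rhom rhop um up A0 t *
      u_delta beta rhom rhop um up A0 t) = fun t => t * (A0 * (up + beta * t)).
    by apply/funext => t; rewrite uE /w_delta w0E; ring.
  have -> : (fun p => two_state X (fun=> rhom) (fun=> rhop) p *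
      two_state X (fun t => um + beta * t) (fun t => up + beta * t) p) =
    two_state X (fun t => rhom * (um + beta * t)) (fun t => rhop * (up + beta * t)).
    by apply/funext => p; rewrite /two_state; case: ifP.
  apply: (three_state_cvg (f := fun A p => rho A p * u A p) cpsi psiM
    (@J2_continuous R beta up) _ _
    (g0 := fun t => A0 * (up + beta * t)) (g1 := fun=> - A0) _ _ e0).
  + by move=> t; apply: cvgM; [exact: cvg_cst|exact: affine_continuous].
  + by move=> t; apply: cvgM; [exact: cvg_cst|exact: affine_continuous].
  + by move=> t; apply: cvgM; [exact: cvg_cst|exact: affine_continuous].
  + exact: cst_continuous.
  near=> A; have eA : 0 < e A by near: A.
  apply/funext => p; rewrite /rho /u /contact_rho /contact_u /three_state J1E starE//.
  case: ifP => // _; case: ifP => // _; rewrite /v_star.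
  by rewrite A0E; field; rewrite gt_eqF.
- rewrite delta_uE.
  (* No Dirac mass for the velocity: the limit is written with a zero one. *)
  have -> : regular_distribution (two_state X (fun t => um + beta * t)
      (fun t => up + beta * t)) psi =
    regular_distribution (two_state X (fun t => um + beta * t)
      (fun t => up + beta * t)) psi + curve_distribution (fun t => t * 0) X psi.
    rewrite /curve_distribution; under [X in _ + X]eq_Rintegral do rewrite mulr0 mul0r.
    by rewrite Rintegral_cst// mul0r addr0.
  apply: (three_state_cvg (f := u) cpsi psiM (@J2_continuous R beta up) _ _
    (g0 := fun=> 0) (g1 := fun=> up - um) _ _ e0); try exact: cst_continuous;
    try exact: affine_continuous.
  near=> A; have eA : 0 < e A by near: A.
  apply/funext => p; rewrite /u /contact_u /three_state J1E /v_star mulr0 addr0.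
  by case: ifP => // _; case: ifP => // _; ring.
Unshelve. all: by end_near.
Qed.
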